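(* Let $(H_2(n))_{n \in \mathbb{N}_0}$ be the two-dimensional Halton sequence in bases $2$ and $3$. There are constants $c_1 > 0$ and $c_2 > 0$ such that for infinitely many $N \in \mathbb{N}$ there exists a set $\Lambda_N \subseteq [0,1)^2$ with the following properties: (i) $\lambda_2(\Lambda_N) \geq c_1$, where $\lambda_2$ denotes two-dimensional Lebesgue measure; (ii) for every $\boldsymbol{x} \in \Lambda_N$ there exists $\boldsymbol{y} \in [0,1)^2$ with $\| \boldsymbol{x} - \boldsymbol{y} \| < \sqrt{8}\, N^{-1/14}$ (Euclidean norm) and \[ \big|\Delta(\boldsymbol{y}, (H_2(n))_{n=1}^N)\big| \geq c_2 (\log N)^2. \]
   Context: For an integer $b \geq 2$, the radical inverse function $\phi_b:\mathbb{N}_0 \to [0,1)$ is $\phi_b(n) = \sum_{j \geq 0} n_j b^{-j-1}$, where $n = \sum_{j\geq 0} n_j b^j$ with digits $n_j \in \{0,\dots,b-1\}$. The two-dimensional Halton sequence in bases $2,3$ is $H_2(n) = (\phi_2(n),\phi_3(n))$, $n = 0,1,2,\dots$. For $\boldsymbol{y} = (y^{(1)},y^{(2)}) \in [0,1]^2$, $\Delta(\boldsymbol{y},(H_2(n))_{n=1}^N) = \sum_{n=1}^N \big(\chi_{[0,y^{(1)})\times[0,y^{(2)})}(H_2(n)) - y^{(1)}y^{(2)}\big)$. $\log$ is the natural logarithm. *)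

(* Defs.v *)
From HB Require Import structures.
From mathcomp Require Import all_boot all_order all_algebra.
From mathcomp Require Import all_classical all_reals all_analysis.
Set Implicit Arguments. Unset Strict Implicit. Unset Printing Implicit Defensive.
Import Order.TTheory GRing.Theory Num.Theory.
Local Open Scope ring_scope.

Definition digit (b n j : nat) : nat := (n %/ b ^ j) %% b.

(* radical inverse phi_b(n) = sum_j n_j b^{-j-1}; digits with j > n vanish
   for b >= 2 since b^j > n, so summing over j < n.+1 is the full sum. *)
Definition radinv {R : realType} (b n : nat) : R :=
  \sum_(j < n.+1) (digit b n j)%:R / (b%:R) ^+ j.+1.

Definition halton23 {R : realType} (n : nat) : R * R :=
  (radinv 2 n, radinv 3 n).

Definition Delta {R : realType} (y : R * R) (N : nat) : R :=
  \sum_(1 <= n < N.+1)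
     ((if ((halton23 n).1 < y.1) && ((halton23 n).2 < y.2) then 1 else 0)
      - y.1 * y.2).

Definition unit_sq {R : realType} : set (R * R) :=
  [set p | 0 <= p.1 < 1 /\ 0 <= p.2 < 1].

Definition dist2 {R : realType} (x y : R * R) : R :=
  Num.sqrt ((x.1 - y.1) ^+ 2 + (x.2 - y.2) ^+ 2).

(* Main.v *)
Require Import Defs.
From HB Require Import structures.
From mathcomp Require Import all_boot all_order all_algebra.
From mathcomp Require Import all_classical all_reals all_analysis.
From mathcomp Require Import zify ring lra.
Import Order.TTheory GRing.Theory Num.Theory.
Local Open Scope classical_set_scope.
Local Open Scope ring_scope.

(** [Lambda_N] can be the whole unit square, for explicit [N].  With [s = 4u], let
[N = 2(6^(5s) - 1)/5] and, for [r < 6^s] carrying the first [s] digits of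
[x^(1)] (base 2) and [x^(2)] (base 3), let [X = r + 6^s (6^(4s) - 1)/5].  Modulo
any [P = 2^(j+1) 3^(l+1)] dividing [6^(5s)], [N] behaves as [-2/5] and [X] as
[r - 6^s/5]; since [6 = 1 mod 5], everything that matters is determined by
[w = P^-1 mod 5].  Truncating the radical inverses of [X] after [12u] or [20u]
digits gives four points near [x], the corners of a rectangle whose local
discrepancy is the alternating sum of the four values of [Delta].  The rectangle
splits into elementary boxes indexed by [12u <= j, l < 20u], and the boxes of
index [(j, l)] together have an excess of at least [d_2 d_3 (1 - 2w/5)] points,
where [d_2], [d_3] are the digits of [X] in base 2 at [j] and in base 3 at [l].
This is 4-periodic in [j] and [l] with mean 1/10, so the excess is quadratic in
[u], and one of the four corners inherits a quarter of it. *)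

(** * Digits, residue classes and counting of integers *)

Section Arithmetic.
Local Open Scope nat_scope.

(** Radical inverses read digits from the least significant one. So this places the radical inverse
    of [n] in the [j]-th block of elementary intervals that fill [[0, y)], where [y] is the radical
    inverse of [X] truncated after more than [j] digits. *)
Definition lt_at_digit (b X j n : nat) : bool :=
  (n == X %[mod b ^ j]) && (digit b n j < digit b X j).

Lemma digitS b n j : digit b n j.+1 = digit b (n %/ b) j.
Proof. by rewrite /digit expnS divnMA. Qed.

Lemma eqn_modM b m n d : 0 < b ->
  (m == n %[mod b * d]) = (m == n %[mod b]) && (m %/ b == n %/ b %[mod d]).
Proof.
move=> b0.
have E k : k %% (b * d) = (k %/ b %% d) * b + k %% b.
  by rewrite modn_divl mulnC {1}(divn_eq (k %% (d * b)) b) modn_dvdm ?dvdn_mull.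
rewrite !E; apply/eqP/andP => [e|[/eqP-> /eqP->]//].
split; apply/eqP.
  by have := congr1 (modn^~ b) e; rewrite !modnMDl !modn_mod.
have D k q : (q * b + k %% b) %/ b = q.
  by rewrite divnMDl // divn_small ?ltn_mod // addn0.
by have := congr1 (divn^~ b) e; rewrite !D.
Qed.

Lemma lt_at_digitS b X j n : 0 < b ->
  lt_at_digit b X j.+1 n =
  (n %% b == X %% b) && lt_at_digit b (X %/ b) j (n %/ b).
Proof. by move=> b0; rewrite /lt_at_digit !digitS expnS eqn_modM // andbA. Qed.

(** Both shifts are written as additions, so that moves in either direction avoid truncated
    subtraction. *)
Lemma digit_shift b j n X a e : 0 < b ->
  n + b ^ j * a = X + b ^ j * e ->
  n = X %[mod b ^ j] /\ digit b n j + a = digit b X j + e %[mod b].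
Proof.
move=> b0 E; have bj : 0 < b ^ j by rewrite expn_gt0 b0.
have := congr1 (modn^~ (b ^ j)) E; have := congr1 (divn^~ (b ^ j)) E.
rewrite ![_ + b ^ j * _]addnC ![b ^ j * _]mulnC !divnMDl // !modnMDl => E1 E2.
split=> //; rewrite /digit !modnDml; congr (_ %% _); lia.
Qed.

(** The quotient [5 * X / B] is at distance less than 1 from [V], which is not a multiple of 5, so
    both lie strictly between the same consecutive multiples of 5. *)
Lemma divn_fifth B V X c1 c2 :
  5 * X + c1 = B * V + c2 -> c1 < c2 + B -> c2 < c1 + B -> V %% 5 != 0 ->
  X %/ B = V %/ 5.
Proof.
move=> E h1 h2 V5.
have B0 : 0 < B by lia.
move: E; rewrite {1}(divn_eq V 5); set v := V %/ 5.
have := ltn_pmod V (isT : 0 < 5); move: V5; set e := V %% 5 => e0 e5 E.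
have {}E : 5 * X + c1 = 5 * (B * v) + e * B + c2 by rewrite E; ring.
have e1 : B <= e * B by rewrite leq_pmull // lt0n.
have e2 : e * B <= 4 * B by rewrite leq_mul2r; apply/orP; right; lia.
apply/eqP; rewrite eqn_leq; apply/andP; split.
  by rewrite -ltnS ltn_divLR //; lia.
by rewrite leq_divRL //; lia.
Qed.

Lemma modn5_exp6 k : 6 ^ k %% 5 = 1.
Proof. by rewrite -modnXm exp1n. Qed.

(** Up to a small error [X] is a fifth of [6 ^ M = b ^ j * (b * G)]. As [6 = 1] modulo 5, [b']
    inverts [b] there and [G] is congruent to [b' ^ j.+1]; hence the digit depends on [j] only
    modulo 4. *)
Lemma digit_fifth b b' M j X c1 c2 : b * b' = 6 -> j < M ->
  5 * X + c1 = 6 ^ M + c2 -> c1 < c2 + b ^ j -> c2 < c1 + b ^ j ->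
  digit b X j = (b * (b' ^ j.+1 %% 5)) %/ 5.
Proof.
move=> bb jM E h1 h2.
have b0 : 0 < b by case: b bb {E h1 h2}.
pose G := b ^ (M - j.+1) * b' ^ M.
have EM : 6 ^ M = b ^ j * (b * G).
  by rewrite -bb expnMn -(subnKC jM) expnD expnS /G (subnKC jM); ring.
have G5 : G %% 5 = b' ^ j.+1 %% 5.
  have : b' ^ j.+1 * 6 ^ M = 6 ^ j.+1 * G.
    by rewrite EM -bb expnMn !expnS; ring.
  move/(congr1 (modn^~ 5)).
  by rewrite -modnMmr modn5_exp6 -[in RHS]modnMml modn5_exp6 muln1 mul1n => ->.
have bG5 : (b * G) %% 5 != 0.
  have : (b ^ j * (b * G)) %% 5 = 1 by rewrite -EM modn5_exp6.
  by rewrite -modnMmr; case: ((b * G) %% 5) => //; rewrite muln0.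
rewrite /digit (@divn_fifth _ (b * G) _ c1 c2) -?EM // -G5.
rewrite {1}(divn_eq G 5).
have -> : b * (G %/ 5 * 5 + G %% 5) = (G %/ 5 * b) * 5 + b * (G %% 5) by ring.
rewrite divnMDl // modnMDl modn_small // ltn_divLR // ltn_mul2l b0 /=.
exact: ltn_pmod.
Qed.

Lemma count_sub (N : nat) (a : pred nat) (s : seq nat) :
  uniq s -> (forall n, n \in s -> [&& 0 < n, n <= N & a n]) ->
  size s <= \sum_(1 <= n < N.+1) a n.
Proof.
move=> us sa.
have -> : \sum_(1 <= n < N.+1) a n = size [seq n <- index_iota 1 N.+1 | a n].
  rewrite size_filter -sum1_count [RHS]big_mkcond /=.
  by apply: eq_bigr => n _; case: (a n).
apply: uniq_leq_size => // n /sa /and3P[n0 nN an].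
by rewrite mem_filter an mem_index_iota n0 ltnS.
Qed.

Lemma odd_exp3 l : exists k, 3 ^ l = k.*2.+1.
Proof.
exists (3 ^ l)./2; rewrite -[LHS]odd_double_half.
by rewrite oddX orbT.
Qed.

(** The shift is [2 ^ j * 3 ^ l] modulo six times that number. Since [3 ^ l] is odd, the binary
    digit at [j] flips; the ternary digit at [l] moves by [2 ^ j] modulo 3. *)
Lemma digits_below j l n X a e :
  n + 2 ^ j * 3 ^ l * (1 + 6 * a) = X + 2 ^ j * 3 ^ l * (6 * e) ->
  [/\ n = X %[mod 2 ^ j], n = X %[mod 3 ^ l],
     (digit 2 n j).+1 = digit 2 X j %[mod 2] &
     digit 3 n l + 2 ^ j = digit 3 X l %[mod 3]].
Proof.
move=> E.
have [||A2 B2] := @digit_shift 2 j n X (3 ^ l * (1 + 6 * a)) (3 ^ l * (6 * e)) => //.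
  by rewrite !(mulnA (2 ^ j)).
have [||A3 B3] := @digit_shift 3 l n X (2 ^ j * (1 + 6 * a)) (2 ^ j * (6 * e)) => //.
  by rewrite !(mulnA (3 ^ l)) [3 ^ l * _]mulnC.
have [k Ek] := odd_exp3 l.
split=> //.
- move: B2; rewrite Ek; clear; nia.
- move: B3; clear; nia.
Qed.

Lemma digits_above j l n X a e :
  n + 2 ^ j * 3 ^ l * (6 * a) = X + 2 ^ j * 3 ^ l * (1 + 6 * e) ->
  [/\ n = X %[mod 2 ^ j], n = X %[mod 3 ^ l],
     (digit 2 n j).+1 = digit 2 X j %[mod 2] &
     digit 3 n l = digit 3 X l + 2 ^ j %[mod 3]].
Proof.
move=> E.
have [||A2 B2] := @digit_shift 2 j n X (3 ^ l * (6 * a)) (3 ^ l * (1 + 6 * e)) => //.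
  by rewrite !(mulnA (2 ^ j)).
have [||A3 B3] := @digit_shift 3 l n X (2 ^ j * (6 * a)) (2 ^ j * (1 + 6 * e)) => //.
  by rewrite !(mulnA (3 ^ l)) [3 ^ l * _]mulnC.
have [k Ek] := odd_exp3 l.
split=> //.
- move: B2; rewrite Ek; clear; nia.
- move: B3; clear; nia.
Qed.

(* With [P = 6p] and [x0 = X mod P], the classes of [x0 - p] and [x0 + p] modulo
[P] consist of numbers agreeing with [X] below the positions [j], [l] and
differing from it at both; each has at least [1 + 2 (H / 5)] elements in
[[1, N]], where [H = 6^M / P]. *)
Lemma lt_at_digit_count M N X c1 c2 j l :
  j < M -> l < M -> 5 * X + c1 = 6 ^ M + c2 -> 5 * N + 2 = 2 * 6 ^ M ->
  c1 < c2 + 2 ^ j -> c2 < c1 + 2 ^ j -> c1 < c2 + 3 ^ l -> c2 < c1 + 3 ^ l ->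
  0 < l ->
  digit 2 X j * digit 3 X l *
    (1 + 2 * ((2 ^ (M - j.+1) * 3 ^ (M - l.+1)) %/ 5)) <=
  \sum_(1 <= n < N.+1) (lt_at_digit 2 X j n && lt_at_digit 3 X l n).
Proof.
move=> jM lM EX EN h1 h2 h3 h4 l0.
set H := 2 ^ _ * _.
have [p Ep] : {p | p = 2 ^ j * 3 ^ l} by eexists.
have EH : 6 ^ M = 6 * p * H.
  have E2 : 2 ^ M = 2 * 2 ^ j * 2 ^ (M - j.+1) by rewrite -expnS -expnD subnKC.
  have E3 : 3 ^ M = 3 * 3 ^ l * 3 ^ (M - l.+1) by rewrite -expnS -expnD subnKC.
  by rewrite -[6]/(2 * 3) expnMn E2 E3 Ep /H; ring.
have H5 : H %% 5 != 0.
  have : (6 * p * H) %% 5 = 1 by rewrite -EH modn5_exp6.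
  by rewrite -modnMmr; case: (H %% 5) => //; rewrite muln0.
have q3 : 2 ^ j %% 3 != 0 by rewrite -/(3 %| 2 ^ j) Euclid_dvdX.
(* This is where [0 < l] enters: the error [2 ^ j] is then at most half of [p], which leaves room
   for [p < x0] and for the bound by [N]. *)
have p2 : 2 * 2 ^ j <= p.
  rewrite Ep [2 * _]mulnC leq_pmul2l ?expn_gt0 //.
  by rewrite (leq_trans (_ : 2 <= 3 ^ 1)) // leq_exp2l.
move: (divn_eq H 5); set h := H %/ 5; set w := H %% 5 => EHw.
have Ephw : 6 * p * H = 30 * (p * h) + 6 * (w * p) by rewrite EHw; ring.
have wp1 : p <= w * p by rewrite leq_pmull // lt0n.
rewrite {}EH {}Ephw in EX EN.
clearbody h w; clear H H5 EHw.
pose x0 := X - 6 * (p * h).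
have Ex0 : X = x0 + 6 * (p * h) by rewrite /x0; lia.
have Ex5 : 5 * x0 + c1 = 6 * (w * p) + c2 by lia.
have x0p : p < x0 by lia.
clearbody x0.
have p60 : 0 < 6 * p by lia.
(* After [2 * h] periods, about [12wp/5] is left of [N], while [x0 + p] is about [6wp/5 + p]; this
   fits because [w >= 1]. *)
have nN n t : t < 1 + 2 * h -> n <= x0 + p + t * (6 * p) -> n <= N.
  move=> th nx.
  have : t * (6 * p) <= (2 * h) * (6 * p) by rewrite leq_mul2r; apply/orP; right; lia.
  have -> : (2 * h) * (6 * p) = 12 * (p * h) by ring.
  lia.
clear EX EN h1 h2 h3 h4 wp1 Ex5.
pose L y := [seq y + t * (6 * p) | t <- iota 0 (1 + 2 * h)].
have uL y : uniq (L y).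
  rewrite map_inj_uniq ?iota_uniq // => t t' /addnI /eqP.
  by rewrite eqn_pmul2r ?p60 // => /eqP.
have sL y : size (L y) = 1 + 2 * h by rewrite size_map size_iota.
have digm n t : n = x0 - p + t * (6 * p) ->
    [/\ n = X %[mod 2 ^ j], n = X %[mod 3 ^ l],
     (digit 2 n j).+1 = digit 2 X j %[mod 2] &
     digit 3 n l + 2 ^ j = digit 3 X l %[mod 3]].
  move=> En; apply: (@digits_below j l n X h t).
  rewrite -Ep En Ex0.
  have -> : p * (1 + 6 * h) = p + 6 * (p * h) by ring.
  have -> : p * (6 * t) = t * (6 * p) by ring.
  by move: x0p; clear; lia.
have digp n t : n = x0 + p + t * (6 * p) ->
    [/\ n = X %[mod 2 ^ j], n = X %[mod 3 ^ l],
     (digit 2 n j).+1 = digit 2 X j %[mod 2] &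
     digit 3 n l = digit 3 X l + 2 ^ j %[mod 3]].
  by move=> En; apply: (@digits_above j l n X h t); rewrite -Ep En Ex0; ring.
have d2 n : digit 2 n j < 2 by rewrite ltn_pmod.
have d3 n : digit 3 n l < 3 by rewrite ltn_pmod.
have [->|d2n0] := eqVneq (digit 2 X j) 0; first by rewrite !mul0n.
have d21 : digit 2 X j = 1 by move: d2n0 (d2 X); clear; lia.
(* If the ternary digit of [X] is 2, both shifts lower it. If it is 1, exactly one of them turns it
   into 0: the downward one when [2 ^ j = 1] modulo 3, the upward one when [2 ^ j = 2]. *)
have okm : digit 3 X l = 2 \/ digit 3 X l = 1 /\ 2 ^ j %% 3 = 1 ->
    forall n, n \in L (x0 - p) ->
    [&& 0 < n, n <= N & lt_at_digit 2 X j n && lt_at_digit 3 X l n].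
  move=> hd n /mapP[t]; rewrite mem_iota /= add0n => th En.
  have [A2 A3 B2 B3] := digm _ _ En.
  rewrite /lt_at_digit A2 A3 !eqxx d21 /=; apply/and4P; split.
  - by move: En x0p; clear; lia.
  - by apply: (nN n t) => //; move: En; clear; lia.
  - by move: B2 d21 (d2 n); clear; lia.
  - by move: B3 hd (d3 n) q3; clear; lia.
have okp : digit 3 X l = 2 \/ digit 3 X l = 1 /\ 2 ^ j %% 3 = 2 ->
    forall n, n \in L (x0 + p) ->
    [&& 0 < n, n <= N & lt_at_digit 2 X j n && lt_at_digit 3 X l n].
  move=> hd n /mapP[t]; rewrite mem_iota /= add0n => th En.
  have [A2 A3 B2 B3] := digp _ _ En.
  rewrite /lt_at_digit A2 A3 !eqxx d21 /=; apply/and4P; split.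
  - by move: En x0p; clear; lia.
  - by apply: (nN n t) => //; move: En; clear; lia.
  - by move: B2 d21 (d2 n); clear; lia.
  - by move: B3 hd (d3 n) q3; clear; lia.
rewrite d21 mul1n.
have [->|d3n0] := eqVneq (digit 3 X l) 0; first by rewrite mul0n.
have [d3E|d3E] := eqVneq (digit 3 X l) 1.
  rewrite d3E mul1n.
  have [q|q] := eqVneq (2 ^ j %% 3) 1.
    by rewrite -(sL (x0 - p)); apply/count_sub/okm => //; right.
  rewrite -(sL (x0 + p)); apply/count_sub/okp => //; right; split=> //.
  by move: q q3 (ltn_pmod (2 ^ j) (isT : 0 < 3)); clear; lia.
have d32 : digit 3 X l = 2 by move: d3E d3n0 (d3 X); clear; lia.
rewrite d32 mulSn mul1n -{1}(sL (x0 - p)) -(sL (x0 + p)) -size_cat.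
apply: count_sub => [|n]; last first.
  by rewrite mem_cat => /orP[]; [apply: okm; left | apply: okp; left].
(* The two progressions are disjoint: their ternary digits at [l] differ by [2 * 2 ^ j], which is
   nonzero modulo 3. *)
rewrite cat_uniq !uL andbT; apply/hasPn => n np; apply/negP => nm.
case/mapP: np => t _ /digp[_ _ _ B]; case/mapP: nm => t' _ /digm[_ _ _ B'].
by move: B B' q3; clear; lia.
Qed.

End Arithmetic.

(** * Truncated radical inverses and elementary intervals *)

Section TruncatedRadicalInverse.
Variables (R : realType) (b : nat).
Hypothesis b1 : (1 < b)%N.

Definition radtrunc (k n : nat) : R :=
  \sum_(0 <= j < k) (digit b n j)%:R / b%:R ^+ j.+1.

Let b_gt0 : 0 < b%:R :> R.
Proof. by rewrite ltr0n ltnW. Qed.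

Let b_neq0 : b%:R != 0 :> R.
Proof. by rewrite gt_eqF. Qed.

Lemma radtrunc0 n : radtrunc 0 n = 0.
Proof. by rewrite /radtrunc big_geq. Qed.

Lemma radtruncS k n :
  radtrunc k.+1 n = ((n %% b)%:R + radtrunc k (n %/ b)) / b%:R.
Proof.
rewrite /radtrunc big_nat_recl // mulrDl expr1 {1}/digit expn0 divn1.
congr (_ + _); rewrite mulr_suml; apply: eq_bigr => j _.
by rewrite digitS [in LHS]exprSr invfM mulrA.
Qed.

Lemma radtrunc_ge0 k n : 0 <= radtrunc k n.
Proof.
by rewrite sumr_ge0 // => j _; rewrite divr_ge0 ?ler0n ?exprn_ge0.
Qed.

Lemma radtrunc_lt1 k n : radtrunc k n < 1.
Proof.
elim: k n => [|k IH] n; first by rewrite radtrunc0.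
rewrite radtruncS ltr_pdivrMr // mul1r.
apply: (@lt_le_trans _ _ ((n %% b)%:R + 1)); first by rewrite ltrD2l.
by rewrite natr1 ler_nat ltn_mod ltnW.
Qed.

Lemma radtruncD s k n :
  radtrunc (s + k) n = radtrunc s n + radtrunc k (n %/ b ^ s) / b%:R ^+ s.
Proof.
elim: s n => [|s IH] n.
  by rewrite radtrunc0 add0r expn0 divn1 expr0 divr1.
rewrite addSn !radtruncS IH expnS divnMA exprS.
by field; rewrite b_neq0 expf_neq0.
Qed.

Lemma eq_radtrunc_mod s n m :
  n = m %[mod b ^ s] -> radtrunc s n = radtrunc s m.
Proof.
elim: s n m => [|s IH] n m; first by rewrite !radtrunc0.
move/eqP; rewrite expnS eqn_modM ?(ltnW b1) // => /andP[/eqP e /eqP /IH E].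
by rewrite !radtruncS E e.
Qed.

Lemma radinv_trunc n k : (n < k)%N -> radinv b n = radtrunc k n.
Proof.
move=> nk; rewrite /radinv /radtrunc (big_cat_nat _ nk) //= big_mkord.
rewrite [X in _ = _ + X]big1_seq ?addr0 // => j.
rewrite mem_index_iota => /andP[_ /andP[nj _]].
rewrite /digit divn_small ?mod0n ?mul0r //.
by rewrite (leq_trans nj) // ltnW // ltn_expl.
Qed.

(** Induction on the first digit: unequal first digits decide the comparison because the tails lie
    in [[0, 1)]; equal ones pass it on to the quotients by [b]. *)
Lemma radtrunc_lt K k n X : (k <= K)%N ->
  (if radtrunc K n < radtrunc k X then 1 else 0) =
  \sum_(0 <= j < k) (lt_at_digit b X j n)%:R :> R.
Proof.
elim: k K n X => [|k IH] [|K] n X //.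
- by rewrite big_geq // !radtrunc0 ltxx.
- by rewrite big_geq // radtrunc0 ltNge radtrunc_ge0.
rewrite ltnS => kK.
rewrite big_nat_recl // {1}/lt_at_digit expn0 !modn1 eqxx /=.
rewrite !radtruncS ltr_pM2r ?invr_gt0 // {1 2}/digit expn0 !divn1.
have := radtrunc_ge0 K (n %/ b); have := radtrunc_lt1 K (n %/ b).
have := radtrunc_ge0 k (X %/ b); have := radtrunc_lt1 k (X %/ b).
under eq_bigr do rewrite lt_at_digitS ?(ltnW b1) //.
case: (ltngtP (n %% b) (X %% b)) => [h|h|->].
- move=> ? ? ? ?; rewrite big1 ?addr0 // ifT //.
  have : (n %% b)%:R + 1 <= (X %% b)%:R :> R by rewrite natr1 ler_nat.
  lra.
- move=> ? ? ? ?; rewrite big1 ?addr0 // ifF //.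
  have : (X %% b)%:R + 1 <= (n %% b)%:R :> R by rewrite natr1 ler_nat.
  move=> ?; apply/negbTE; rewrite -leNgt; lra.
by move=> _ _ _ _; rewrite ltrD2l add0r IH.
Qed.

Lemma radinv_lt k n X :
  (if radinv b n < radtrunc k X then 1 else 0) =
  \sum_(0 <= j < k) (lt_at_digit b X j n)%:R :> R.
Proof.
rewrite (@radinv_trunc n (n.+1 + k)) ?leq_addr //.
by rewrite radtrunc_lt // leq_addl.
Qed.

(** Greedy expansion: the first digit is the integer part of [b * x], and it becomes the lowest
    digit of [a]. *)
Lemma radtrunc_approx s (x : R) : 0 <= x < 1 ->
  exists a, radtrunc s a <= x < radtrunc s a + (b%:R ^+ s)^-1.
Proof.
elim: s x => [|s IH] x x01.
  by exists 0%N; rewrite radtrunc0 expr0 invr1 add0r.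
have [x0 x1] := andP x01.
have bx0 : 0 <= b%:R * x by rewrite mulr_ge0 // ltW.
have /andP[d1 d2] := truncn_itv bx0.
set d := Num.truncn (b%:R * x) in d1 d2.
have db : (d < b)%N.
  by rewrite -(ltr_nat R) (le_lt_trans d1) // gtr_pMr.
have [|a /andP[a1 a2]] := IH (b%:R * x - d%:R).
  by rewrite subr_ge0 d1 ltrBlDl natr1.
exists (a * b + d)%N.
rewrite radtruncS modnMDl modn_small // divnMDl ?(ltnW b1) // divn_small // addn0.
rewrite exprS invfM -[_^-1 * _^-1]mulrC -mulrDl ler_pdivrMr // ltr_pdivlMr //.
by rewrite [x * _]mulrC; apply/andP; split; move: a1 a2; lra.
Qed.

Lemma radtrunc_near s k (x : R) a X : (s <= k)%N ->
  radtrunc s a <= x < radtrunc s a + (b%:R ^+ s)^-1 ->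
  X = a %[mod b ^ s] -> `|x - radtrunc k X| <= (b%:R ^+ s)^-1.
Proof.
move=> sk /andP[x1 x2] /eq_radtrunc_mod E.
rewrite -(subnKC sk) radtruncD E.
set t := radtrunc _ _ / _.
have t0 : 0 <= t by rewrite divr_ge0 ?radtrunc_ge0 ?exprn_ge0.
have t1 : t <= (b%:R ^+ s)^-1.
  by rewrite ler_pdivrMr ?exprn_gt0 // mulVf ?expf_neq0 // ltW // radtrunc_lt1.
by rewrite ler_norml; apply/andP; split; move: x1 x2 t0 t1; lra.
Qed.

End TruncatedRadicalInverse.

(** * Discrepancy of elementary boxes *)

Section BoxDiscrepancy.
Variable R : realType.

(** The block of index [j] consists of [digit b X j] intervals of length [b ^- j.+1], so the
    subtracted product is [N] times the area of the boxes of index [(j, l)]. *)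
Definition box_term X N j l : R :=
  (\sum_(1 <= n < N.+1) (lt_at_digit 2 X j n && lt_at_digit 3 X l n))%:R
  - N%:R * ((digit 2 X j)%:R / 2 ^+ j.+1) * ((digit 3 X l)%:R / 3 ^+ l.+1).

Lemma Delta_trunc X N k1 k2 :
  Delta (radtrunc R 2 k1 X, radtrunc R 3 k2 X) N =
  \sum_(0 <= j < k1) \sum_(0 <= l < k2) box_term X N j l.
Proof.
transitivity (\sum_(1 <= n < N.+1) \sum_(0 <= j < k1) \sum_(0 <= l < k2)
  ((lt_at_digit 2 X j n && lt_at_digit 3 X l n)%:R
   - ((digit 2 X j)%:R / 2 ^+ j.+1) * ((digit 3 X l)%:R / 3 ^+ l.+1)) : R).
  apply: eq_bigr => n _ /=.
  under eq_bigr do rewrite sumrB.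
  rewrite sumrB -big_distrlr; congr (_ - _).
  under eq_bigr do under eq_bigr do rewrite -mulnb natrM.
  rewrite -big_distrlr /= -!(@radinv_lt R _ _) //.
  by case: (_ < _); case: (_ < _); rewrite ?mulr1 ?mulr0.
rewrite exchange_big; apply: eq_bigr => j _.
rewrite exchange_big; apply: eq_bigr => l _ /=.
by rewrite sumrB /box_term natr_sum sumr_const_nat subn1 -[in RHS]mulrA [in RHS]mulr_natl.
Qed.

(** Inclusion-exclusion discards the small indices, at which the digits of [X] are those of the
    given point and cannot be controlled. *)
Lemma Delta_box X N j0 j1 l0 l1 : (j0 <= j1)%N -> (l0 <= l1)%N ->
  Delta (radtrunc R 2 j1 X, radtrunc R 3 l1 X) N
  - Delta (radtrunc R 2 j0 X, radtrunc R 3 l1 X) N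
  - Delta (radtrunc R 2 j1 X, radtrunc R 3 l0 X) N
  + Delta (radtrunc R 2 j0 X, radtrunc R 3 l0 X) N =
  \sum_(j0 <= j < j1) \sum_(l0 <= l < l1) box_term X N j l.
Proof.
move=> hj hl; rewrite !Delta_trunc.
have cut a c : \sum_(a <= j < c) \sum_(0 <= l < l1) box_term X N j l =
    \sum_(a <= j < c) \sum_(0 <= l < l0) box_term X N j l +
    \sum_(a <= j < c) \sum_(l0 <= l < l1) box_term X N j l.
  by rewrite -big_split; apply: eq_bigr => j _; rewrite -big_cat_nat.
by rewrite !cut !(@big_cat_nat _ _ _ j0 0 j1) //=; ring.
Qed.

(* Since [2 * 3 = 1] modulo 5, [3 ^ j.+1] and [2 ^ l.+1] are the inverses of
[2 ^ j.+1] and [3 ^ l.+1] there. *)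
Definition main_term j l : R :=
  (((2 * (3 ^ j.+1 %% 5)) %/ 5) * ((3 * (2 ^ l.+1 %% 5)) %/ 5))%:R *
  (1 - 2 / 5 * ((3 ^ j.+1 %% 5) * (2 ^ l.+1 %% 5) %% 5)%:R).

Lemma sum_periodic4 (f : nat -> R) a n : (forall i, f (i + 4)%N = f i) ->
  \sum_(4 * a <= i < 4 * (a + n)) f i = (f 0 + f 1 + f 2 + f 3) *+ n.
Proof.
move=> f4.
have fM k i : f (4 * k + i)%N = f i.
  elim: k => [|k IH]; first by rewrite muln0.
  by rewrite mulnS -addnA addnC f4.
elim: n => [|n IH]; first by rewrite addn0 big_geq // mulr0n.
have -> : (4 * (a + n.+1) = (4 * (a + n)).+4)%N by lia.
rewrite !big_nat_recr ?IH /=; try lia.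
have := fM (a + n)%N; set m := (4 * (a + n))%N => fm.
have := fm 0; have := fm 1; have := fm 2; have := fm 3.
rewrite addn0 addn1 addn2 addn3 => -> -> -> ->.
by rewrite [RHS]mulrSr !addrA.
Qed.

Lemma sum_main_term u :
  \sum_(12 * u <= j < 20 * u) \sum_(12 * u <= l < 20 * u) main_term j l =
  32 / 5 * u%:R ^+ 2.
Proof.
(* Each index runs over [2 * u] full periods of length 4. *)
have -> : (12 * u = 4 * (3 * u))%N by lia.
have -> : (20 * u = 4 * (3 * u + 2 * u))%N by lia.
have p3 j : (3 ^ (j + 4).+1 %% 5 = 3 ^ j.+1 %% 5)%N.
  by rewrite -addSn expnD -modnMmr muln1.
have p2 j : (2 ^ (j + 4).+1 %% 5 = 2 ^ j.+1 %% 5)%N.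
  by rewrite -addSn expnD -modnMmr muln1.
rewrite sum_periodic4; last first.
  by move=> j; apply: eq_bigr => l _; rewrite /main_term p3.
rewrite !sum_periodic4; try by move=> l; rewrite /main_term p2.
rewrite /main_term /=.
have -> : (3 ^ 1 %% 5 = 3)%N by [].
have -> : (3 ^ 2 %% 5 = 4)%N by [].
have -> : (3 ^ 3 %% 5 = 2)%N by [].
have -> : (3 ^ 4 %% 5 = 1)%N by [].
have -> : (2 ^ 1 %% 5 = 2)%N by [].
have -> : (2 ^ 2 %% 5 = 4)%N by [].
have -> : (2 ^ 3 %% 5 = 3)%N by [].
have -> : (2 ^ 4 %% 5 = 1)%N by [].
rewrite /= /divn /modn /=.
rewrite -!mulrnDl -mulrnA !mul0n !muln0 !mul0r !mul1n.
(* The 16 terms of one period square add up to [8 / 5], and there are [4 * u ^ 2] such squares. *)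
set S := (X in X *+ _); have -> : S = 8 / 5 by rewrite /S; lra.
by rewrite -[LHS]mulr_natr !natrM; field.
Qed.

(** With [H = 5h + w], the count is at least [1 + 2h] per unit of [d_2 d_3], while the expected
    number is at most [2H/5 = 2h + 2w/5]; the difference is [1 - 2w/5]. *)
Lemma box_term_ge M N X c1 c2 j l :
  (j < M)%N -> (l < M)%N ->
  (5 * X + c1 = 6 ^ M + c2)%N -> (5 * N + 2 = 2 * 6 ^ M)%N ->
  (c1 < c2 + 2 ^ j)%N -> (c2 < c1 + 2 ^ j)%N ->
  (c1 < c2 + 3 ^ l)%N -> (c2 < c1 + 3 ^ l)%N -> (0 < l)%N ->
  main_term j l <= box_term X N j l.
Proof.
move=> jM lM EX EN h1 h2 h3 h4 l0.
have := @lt_at_digit_count M N X c1 c2 j l jM lM EX EN h1 h2 h3 h4 l0.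
rewrite /box_term /main_term.
rewrite (@digit_fifth 2 3 M j X c1 c2) // (@digit_fifth 3 2 M l X c1 c2) //.
set e2 := (_ %/ 5)%N; set e3 := (_ %/ 5)%N; set cnt := (\sum_(_ <= _ < _) _)%N.
set H := (2 ^ _ * 3 ^ _)%N.
have E2 : (2 ^ M = 2 ^ j.+1 * 2 ^ (M - j.+1))%N by rewrite -expnD subnKC.
have E3 : (3 ^ M = 3 ^ l.+1 * 3 ^ (M - l.+1))%N by rewrite -expnD subnKC.
have EH : (6 ^ M = 2 ^ j.+1 * 3 ^ l.+1 * H)%N.
  by rewrite -[6%N]/(2 * 3)%N expnMn E2 E3 /H; ring.
have EHw : (H %% 5 = (3 ^ j.+1 %% 5) * (2 ^ l.+1 %% 5) %% 5)%N.
  have : (3 ^ j.+1 * 2 ^ l.+1 * 6 ^ M = 6 ^ (j.+1 + l.+1) * H)%N.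
    by rewrite EH expnD -[6%N]/(2 * 3)%N !expnMn; ring.
  move/(congr1 (modn^~ 5%N)); rewrite -modnMmr modn5_exp6 muln1 => E.
  by rewrite modnMm E -modnMml modn5_exp6 mul1n.
rewrite -EHw => hc.
have {}hc : (e2 * e3)%:R * (1 + 2 * (H %/ 5)%:R) <= cnt%:R :> R.
  by rewrite -natrM -(natrD _ 1) -natrM ler_nat.
have HR : H%:R = (H %/ 5)%:R * 5 + (H %% 5)%:R :> R.
  by rewrite -natrM -natrD -divn_eq.
have NR : N%:R / (2 ^+ j.+1 * 3 ^+ l.+1) <= 2 / 5 * H%:R :> R.
  rewrite ler_pdivrMr ?mulr_gt0 ?exprn_gt0 //.
  have : 5 * N%:R + 2 = 2 * (2 ^+ j.+1 * 3 ^+ l.+1 * H%:R) :> R.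
    by rewrite -!natrX -!natrM -natrD EN EH.
  by set Q := 2 ^+ _ * _; lra.
apply: le_trans (lerB hc (lexx _)).
have -> : N%:R * (e2%:R / 2 ^+ j.+1) * (e3%:R / 3 ^+ l.+1) =
  (e2 * e3)%:R * (N%:R / (2 ^+ j.+1 * 3 ^+ l.+1)) :> R.
  by rewrite natrM; field; rewrite !expf_neq0 //.
rewrite -mulrBr ler_wpM2l // ?ler0n //.
by move: NR; rewrite HR; lra.
Qed.

End BoxDiscrepancy.

(** * Prescribing the low digits of an integer close to a fifth of a power of 6 *)

Lemma exists_expansion a1 a2 s : exists X c,
  [/\ (5 * X + 6 ^ s = 6 ^ (5 * s) + c)%N, (c < 5 * 6 ^ s)%N,
      X = a1 %[mod 2 ^ s] & X = a2 %[mod 3 ^ s]].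
Proof.
have co : coprime (2 ^ s) (3 ^ s) by rewrite coprimeXl // coprimeXr.
have E6 : (6 ^ s = 2 ^ s * 3 ^ s)%N by rewrite -expnMn.
pose r := (chinese (2 ^ s) (3 ^ s) a1 a2 %% 6 ^ s)%N.
(* The division leaves remainder 1, so [X = 6 ^ s * T + r] gives
   [5 * X = 6 ^ (5 * s) - 6 ^ s + 5 * r]. *)
pose T := (6 ^ (4 * s) %/ 5)%N.
have ET : (6 ^ (4 * s) = T * 5 + 1)%N.
  by rewrite {1}(divn_eq (6 ^ (4 * s)) 5) modn5_exp6.
have r6 : (r < 6 ^ s)%N by rewrite ltn_pmod ?expn_gt0.
exists (6 ^ s * T + r)%N, (5 * r)%N; split.
- rewrite (_ : 5 * s = s + 4 * s)%N; last by lia.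
  by rewrite [in RHS]expnD ET; ring.
- by rewrite ltn_pmul2l.
- rewrite E6 -modnDm -mulnA modnMr add0n modn_mod.
  by rewrite /r E6 modn_dvdm ?dvdn_mulr // chinese_modl.
rewrite E6 -modnDm mulnAC modnMl add0n modn_mod.
by rewrite /r E6 modn_dvdm ?dvdn_mull // chinese_modr.
Qed.

(** Makes the error [c - 6 ^ s] smaller than [b ^ j] as soon as [j >= 3 * s], hence the lower index
    [12 * u] for [s = 4 * u]. *)
Lemma leq_4exp6 s : (5 <= s)%N -> (4 * 6 ^ s <= 2 ^ (3 * s))%N.
Proof.
move=> /subnKC <-; set r := (s - 5)%N.
rewrite expnM -[(2 ^ 3)%N]/(2 * 4)%N -[6%N]/(2 * 3)%N !expnMn mulnCA leq_mul2l.
apply/orP; right; rewrite !expnD mulnA leq_mul //.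
by case: r => // r; rewrite leq_exp2r.
Qed.

(** * Size of [N], measure of the square and choice of a corner *)

Section Main.
Variable R : realType.

(** Source of the exponent [1/14]: [6 ^ 5 <= 2 ^ 14], so [2 ^- s] is at most [N] to the power
    [-1/14] when [N <= 6 ^ (5 * s)]. *)
Lemma leq_exp6_exp2 s : (6 ^ (5 * s) <= (2 ^ s) ^ 14)%N.
Proof.
have -> : ((2 ^ s) ^ 14 = (2 ^ 5) ^ s * (2 ^ 9) ^ s)%N.
  by rewrite -!expnM -expnD; congr (_ ^ _)%N; lia.
rewrite -[6%N]/(2 * 3)%N expnMn !expnM leq_mul2l; apply/orP; right.
by case: s => // s; rewrite leq_exp2r.
Qed.

Lemma powR_inv14 N s : (0 < N)%N -> (N <= (2 ^ s) ^ 14)%N ->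
  (2 ^+ s)^-1 <= N%:R `^ (- (14%:R)^-1) :> R.
Proof.
move=> N0 Ns.
rewrite powRN lef_pV2 ?posrE ?powR_gt0 ?ltr0n ?exprn_gt0 //.
have -> : 2 ^+ s = ((2 ^+ s) ^+ 14) `^ (14%:R^-1) :> R.
  by rewrite -[_ ^+ 14]powR_mulrn ?exprn_ge0 // -powRrM mulfV ?pnatr_eq0 // powRr1 ?exprn_ge0.
apply: ge0_ler_powR; rewrite ?nnegrE ?invr_ge0 ?ler0n ?exprn_ge0 //.
by rewrite -!natrX ler_nat.
Qed.

Lemma ln_le_exp2_14 N s : (0 < N)%N -> (N <= (2 ^ s) ^ 14)%N ->
  0 <= ln (N%:R : R) <= 14 * s%:R.
Proof.
move=> N0 Ns; rewrite ln_ge0 ?ler1n //=.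
apply: (@le_trans _ _ (ln ((2 : R) ^+ (s * 14)))).
  rewrite ler_ln ?posrE ?ltr0n ?exprn_gt0 //.
  by rewrite -natrX ler_nat expnM.
rewrite lnXn // -[leLHS]mulr_natl natrM [s%:R * _]mulrC -[leRHS]mulr1.
rewrite ler_wpM2l ?mulr_ge0 //.
(* Only [ln 2 <= 1] is used. *)
by have := @le_ln1Dx R 1; apply; lra.
Qed.

Lemma dist2_lt (x y : R * R) d e : 0 < d -> d <= e ->
  `|x.1 - y.1| <= d -> `|x.2 - y.2| <= d -> dist2 x y < Num.sqrt 8 * e.
Proof.
move=> d0 de h1 h2.
apply: (@lt_le_trans _ _ (Num.sqrt 8 * d)); last by rewrite ler_wpM2l ?sqrtr_ge0.
have -> : Num.sqrt 8 * d = Num.sqrt (8 * d ^+ 2).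
  by rewrite sqrtrM // sqrtr_sqr ger0_norm // ltW.
rewrite /dist2 ltr_sqrt; last by rewrite mulr_gt0 ?exprn_gt0.
have q z : `|z| <= d -> z ^+ 2 <= d ^+ 2.
  by move=> zd; rewrite -(real_normK (num_real z)) lerXn2r ?nnegrE ?(ltW d0).
have := q _ h1; have := q _ h2.
have : 0 < d ^+ 2 by rewrite exprn_gt0.
lra.
Qed.

Lemma unit_sqE : unit_sq = `[0, 1[ `*` `[0, 1[ :> set (R * R).
Proof. by apply/seteqP; split=> -[a b] /=; rewrite !in_itv /=. Qed.

Lemma measurable_unit_sq : measurable (unit_sq : set (R * R)).
Proof. by rewrite unit_sqE; apply: measurableX; apply: measurable_itv. Qed.

Lemma lebesgue_unit_sq :
  (((@lebesgue_measure R) \x (@lebesgue_measure R)) unit_sq = 1)%E.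
Proof.
have itv1 : lebesgue_measure (`[0, 1[ : set R) = 1%E.
  by rewrite lebesgue_measure_itv /= lte_fin ltr01 sube0.
rewrite unit_sqE product_measure1E; [|exact: measurable_itv..].
by rewrite -[RHS]mule1; congr (_ * _)%E; exact: itv1.
Qed.

Lemma large_Delta u N (x : R * R) : (2 <= u)%N ->
  (5 * N + 2 = 2 * 6 ^ (20 * u))%N -> unit_sq x ->
  exists y, unit_sq y /\
    (`|x.1 - y.1| <= (2 ^+ (4 * u))^-1 /\ `|x.2 - y.2| <= (2 ^+ (4 * u))^-1) /\
    8 / 5 * u%:R ^+ 2 <= `|Delta y N|.
Proof.
move=> u2.
have u5 : (5 <= 4 * u)%N by lia.
have u12 : (0 < 12 * u)%N by lia.
have hu : (12 * u <= 20 * u)%N by lia.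
have h12 : (4 * u <= 12 * u)%N by lia.
have h20 : (4 * u <= 20 * u)%N by lia.
have E12 : (3 * (4 * u) = 12 * u)%N by lia.
have E20 : (5 * (4 * u) = 20 * u)%N by lia.
move=> EN [x1 x2].
have [a1 A1] := @radtrunc_approx R 2 isT (4 * u) _ x1.
have [a2 A2] := @radtrunc_approx R 3 isT (4 * u) _ x2.
have [X [c [EX c5 X1 X2]]] := exists_expansion a1 a2 (4 * u).
rewrite E20 in EX.
have near k1 k2 : (4 * u <= k1)%N -> (4 * u <= k2)%N ->
    8 / 5 * u%:R ^+ 2 <= `|Delta (radtrunc R 2 k1 X, radtrunc R 3 k2 X) N| ->
  exists y, unit_sq y /\
    (`|x.1 - y.1| <= (2 ^+ (4 * u))^-1 /\ `|x.2 - y.2| <= (2 ^+ (4 * u))^-1) /\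
    8 / 5 * u%:R ^+ 2 <= `|Delta y N|.
  move=> hk1 hk2 h; exists (radtrunc R 2 k1 X, radtrunc R 3 k2 X); split.
    by split; rewrite /= radtrunc_ge0 ?radtrunc_lt1.
  split=> //; split => /=; first exact: (@radtrunc_near R 2 isT (4 * u) k1 _ a1).
  apply: le_trans (@radtrunc_near R 3 isT (4 * u) k2 _ a2 X hk2 A2 X2) _.
  by rewrite lef_pV2 ?posrE ?exprn_gt0 // lerXn2r ?nnegrE // ler_nat.
have bnd (b j : nat) : (1 < b)%N -> (12 * u <= j)%N ->
    (6 ^ (4 * u) < c + b ^ j)%N /\ (c < 6 ^ (4 * u) + b ^ j)%N.
  move=> b1 hj.
  have h6 : (4 * 6 ^ (4 * u) <= b ^ j)%N.
    apply: leq_trans (leq_4exp6 _ u5) _; rewrite E12.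
    apply: (@leq_trans (b ^ (12 * u))); last by rewrite leq_exp2l.
    by rewrite leq_exp2r.
  have : (0 < 6 ^ (4 * u))%N by rewrite expn_gt0.
  by move: h6 c5; clear; lia.
have : 32 / 5 * u%:R ^+ 2 <=
    \sum_(12 * u <= j < 20 * u) \sum_(12 * u <= l < 20 * u) box_term R X N j l.
  rewrite -sum_main_term big_nat_cond [leRHS]big_nat_cond.
  apply: ler_sum => j /andP[/andP[j1 j2] _].
  rewrite big_nat_cond [leRHS]big_nat_cond.
  apply: ler_sum => l /andP[/andP[l1 l2] _].
  have [b1 b2] := bnd 2 j isT j1; have [b3 b4] := bnd 3 l isT l1.
  apply: (@box_term_ge R (20 * u) N X _ _ j l j2 l2 EX EN b1 b2 b3 b4).
  exact: leq_trans l1.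
rewrite -Delta_box // => big.
(* If all four corners stayed below [8 / 5 * u ^ 2] in absolute value, their alternating sum would
   be below [32 / 5 * u ^ 2]. *)
have [/near|s1] := leP (8 / 5 * u%:R ^+ 2)
  `|Delta (radtrunc R 2 (20 * u) X, radtrunc R 3 (20 * u) X) N|; first exact.
have [/near|s2] := leP (8 / 5 * u%:R ^+ 2)
  `|Delta (radtrunc R 2 (12 * u) X, radtrunc R 3 (20 * u) X) N|; first exact.
have [/near|s3] := leP (8 / 5 * u%:R ^+ 2)
  `|Delta (radtrunc R 2 (20 * u) X, radtrunc R 3 (12 * u) X) N|; first exact.
have [/near|s4] := leP (8 / 5 * u%:R ^+ 2)
  `|Delta (radtrunc R 2 (12 * u) X, radtrunc R 3 (12 * u) X) N|; first exact.
move: s1 s2 s3 s4 big; rewrite !ltr_norml.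
clear; move=> /andP[? ?] /andP[? ?] /andP[? ?] /andP[? ?] ?; lra.
Qed.

End Main.

Theorem theorem5 (R : realType) :
  exists c1 c2 : R, 0 < c1 /\ 0 < c2 /\
  forall M : nat, exists N : nat, (M < N)%N /\
    exists Lam : set (R * R),
      measurable Lam /\ Lam `<=` unit_sq /\
      (c1%:E <= ((@lebesgue_measure R) \x (@lebesgue_measure R)) Lam)%E /\
      forall x, Lam x ->
        exists y, unit_sq y /\
          dist2 x y < Num.sqrt 8 * (N%:R `^ (- (14%:R)^-1)) /\
          c2 * (ln (N%:R)) ^+ 2 <= `| Delta y N |.
Proof.
(* Here [ln N <= 14 * 4u = 56u], and [56 ^ 2 / 2000 = 1.568] is below the [8 / 5] available at a
   corner. *)
exists 1, (2000^-1); split; first exact: ltr01.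
split; first by rewrite invr_gt0 ltr0n.
move=> M.
have [u u2 Mu] : exists2 u, (1 < u)%N & (M < u)%N by exists (M + 2)%N; lia.
have [N EN] : exists N, (5 * N + 2 = 2 * 6 ^ (20 * u))%N.
  exists (2 * (6 ^ (20 * u) %/ 5))%N.
  move: (divn_eq (6 ^ (20 * u)) 5) (modn5_exp6 (20 * u)).
  by move: (6 ^ (20 * u))%N; clear; lia.
have MN : (M < N)%N.
  have := @ltn_expl 6 (20 * u) isT.
  by move: EN Mu; move: (6 ^ (20 * u))%N; clear; lia.
have N14 : (N <= (2 ^ (4 * u)) ^ 14)%N.
  apply: leq_trans (leq_exp6_exp2 _); rewrite mulnA.
  by move: EN; move: (6 ^ (5 * 4 * u))%N; clear; lia.
exists N; split=> //; exists unit_sq.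
split; first exact: measurable_unit_sq.
split=> //; split; first by rewrite lebesgue_unit_sq.
move=> x /(@large_Delta R u N x _ EN)[|y [y01 [[d1 d2] D]]]; first exact: u2.
have N0 : (0 < N)%N by apply: leq_ltn_trans MN.
exists y; split=> //; split.
  apply: (@dist2_lt R x y _ _ _ (powR_inv14 R _ _ N0 N14) d1 d2).
  by rewrite invr_gt0 exprn_gt0.
apply: le_trans D.
have /andP[l0 l1] := ln_le_exp2_14 R _ _ N0 N14.
have : ln (N%:R : R) ^+ 2 <= (14 * (4 * u)%:R) ^+ 2 by rewrite lerXn2r ?nnegrE ?mulr_ge0.
have : 0 <= u%:R ^+ 2 :> R by rewrite exprn_ge0.
by rewrite natrM !exprMn; clear; lra.
Qed.
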